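(* Let $K$ be a field and let $n,t\geq 1$ be integers. Let $p_1,\ldots,p_t\in\mathbb{A}^n(K)=K^n$ be points with $p_i\neq p_j$ whenever $i\neq j$. For each $i=1,\ldots,t$ let $s(i)\geq 1$, let $U_{i,1},\ldots,U_{i,s(i)}\in K^n$ be linearly independent unitary vectors, and let $H_i\subseteq\mathbb{N}^{s(i)}$ be a finite set. Let $v_{i,h}\in K$ be arbitrary for $i=1,\ldots,t$ and $h\in H_i$. Then there exists a polynomial $F\in K[X_1,\ldots,X_n]$ such that $$D^{(h)}F(p_i)=v_{i,h}\quad\text{for every } i=1,\ldots,t \text{ and every } h\in H_i.$$
   Context: $\mathbb{N}=\{0,1,2,\ldots\}$. A vector $U=(u_1,\ldots,u_n)\in K^n$ is unitary if it has unit length, i.e. $u_1^2+\cdots+u_n^2=1$. For $U\in K^n$ and $h\in\mathbb{N}$, $D_U^{(h)}$ denotes the order-$h$ derivative in the direction $U$ on $K[X_1,\ldots,X_n]$, normalized so that the Leibniz rule reads $D_U^{(h)}(FG)=\sum_{k=0}^h D_U^{(h-k)}F\cdot D_U^{(k)}G$. Explicitly, $D_U^{(h)}F$ is the coefficient of $s^h$ in $F(X+sU)\in K[X_1,\ldots,X_n][s]$, where $X=(X_1,\ldots,X_n)$ and $s$ is an auxiliary variable; thus $D_U^{(0)}F=F$ and $D_U^{(1)}F$ is the usual directional derivative. For an index $i$ and $h=(h_1,\ldots,h_{s(i)})\in\mathbb{N}^{s(i)}$, when the derivative is evaluated at $p_i$, one sets $$D^{(h)}F=D^{(h_1)}_{U_{i,1}}\cdots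 D^{(h_{s(i)})}_{U_{i,s(i)}}F,$$ using the vectors attached to the index $i$. The sets $H_i$ are not assumed to be closed under passing to componentwise smaller indices (gaps in the prescribed derivatives are allowed). *)

(* Defs.v *)
From HB Require Import structures.
From mathcomp Require Import all_boot all_order all_algebra.
From mathcomp Require Import finmap mpoly.

Set Implicit Arguments.
Unset Strict Implicit.
Unset Printing Implicit Defensive.

Import GRing.Theory.
Local Open Scope ring_scope.

Definition unitary (K : fieldType) (n : nat) (u : 'rV[K]_n) : Prop :=
  \sum_(k < n) u 0 k ^+ 2 = 1.

(* F(X + s U); the auxiliary variable s is the 'X of the outer {poly _}. *)
Definition translate_along (K : fieldType) (n : nat) (u : 'rV[K]_n)
    (F : {mpoly K[n]}) : {poly {mpoly K[n]}} :=
  mmap (fun c : K => c%:MP_[n]%:P)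
       (fun k : 'I_n => ('X_k : {mpoly K[n]})%:P + ((u 0 k)%:MP_[n]) *: 'X) F.

(* Coefficient of s^h in F(X + s U): a Hasse derivative, so no factor h! *)
Definition dir_deriv (K : fieldType) (n : nat) (u : 'rV[K]_n) (h : nat)
    (F : {mpoly K[n]}) : {mpoly K[n]} :=
  (translate_along u F)`_h.

(* The directions are the rows of U, and row 0 is the outermost operator. *)
Definition multi_deriv (K : fieldType) (n s : nat) (U : 'M[K]_(s, n))
    (h : {ffun 'I_s -> nat}) (F : {mpoly K[n]}) : {mpoly K[n]} :=
  foldr (fun (j : 'I_s) (G : {mpoly K[n]}) => dir_deriv (row j U) (h j) G)
        F (enum 'I_s).

(* Main.v *)
Require Import Defs.
From HB Require Import structures.
From mathcomp Require Import all_boot all_order all_algebra.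
From mathcomp Require Import finmap mpoly.
From mathcomp Require Import zify.

Set Implicit Arguments.
Unset Strict Implicit.
Unset Printing Implicit Defensive.

Import GRing.Theory.
Local Open Scope ring_scope.

(** Fix a point p_i.  The rows of U_i are independent, so U_i has a right
    inverse V, and the columns of V give affine forms l_1, ..., l_s vanishing at
    p_i with l_j(X + a U_{i,k}) = l_j(X) + [j = k] a.  They behave like
    coordinates: D^(h) sends prod_j l_j^{g_j} to
    prod_j C(g_j, h_j) l_j^{g_j - h_j}, whose value at p_i is 1 if g = h and 0
    otherwise, in any characteristic.  Hence
    G_i = sum_{h in H_i} v_{i,h} prod_j l_j^{h_j} has the prescribed derivatives
    at the single point p_i ([exists_prescribed_multi_deriv]).

    The points are then decoupled as in the Chinese remainder theorem.  If N
    exceeds all the total orders |h| and f(q) = 0, then D^(h) (f^N g) is still a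
    multiple of f, so it vanishes at q ([multi_deriv_pow_eq0]).  Let L_{ij} be
    an affine form equal to 1 at p_i and 0 at p_j, put
    Q_i = prod_{j != i} L_{ij}^N and E_i = 1 - (1 - Q_i)^N.  At p_i, E_i is
    1 minus an N-th power of a polynomial vanishing there; at p_j, it is a
    multiple of Q_i, hence of L_{ij}^N ([exists_local_idempotent]).  So E_i G_i
    has the same derivatives as G_i at p_i and zero derivatives at the other
    points, and F = sum_i E_i G_i interpolates all the values. *)

(** * Derivatives along one direction *)

Lemma coef_exp_CaddX (R : comNzRingType) (c : R) m a :
  ((c%:P + 'X) ^+ m)`_a = c ^+ (m - a) *+ 'C(m, a).
Proof.
rewrite exprDn coef_sum.
under eq_bigr => k _ do rewrite coefMn -polyC_exp coefCM coefXn.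
have [le_am | lt_ma] := leqP a m; last first.
  rewrite bin_small // mulr0n big1 // => k _.
  by rewrite gtn_eqF ?mulr0 ?mul0rn // (leq_ltn_trans _ lt_ma) // -ltnS.
rewrite (bigD1 (Ordinal (n := m.+1) (m := a) le_am)) //= eqxx mulr1.
rewrite big1 ?addr0 // => k; rewrite -val_eqE /= eq_sym => /negPf ->.
by rewrite mulr0 mul0rn.
Qed.

Section DirectionalDerivative.

Variables (K : fieldType) (n : nat).
Implicit Types (u p q : 'rV[K]_n) (F G f : {mpoly K[n]}).

Local Notation "F @! p" := (F.@[fun k => p 0 k]) (at level 2).

(** Writing the coefficient map as a composition exposes it as a ring morphism,
    which makes F |-> F(X + sU) a ring morphism too; the definition hides this
    behind a lambda. *)
Lemma translate_alongE u F :
  translate_along u F =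
  mmap (polyC \o @mpolyC n K)
       (fun k => ('X_k : {mpoly K[n]})%:P + ((u 0 k)%:MP_[n]) *: 'X) F.
Proof. by []. Qed.

Lemma translate_alongD u F G :
  translate_along u (F + G) = translate_along u F + translate_along u G.
Proof. by rewrite !translate_alongE raddfD. Qed.

Lemma translate_alongM u F G :
  translate_along u (F * G) = translate_along u F * translate_along u G.
Proof. by rewrite !translate_alongE rmorphM. Qed.

Lemma translate_alongX u F m :
  translate_along u (F ^+ m) = translate_along u F ^+ m.
Proof. by rewrite !translate_alongE rmorphXn. Qed.

Lemma translate_along_prod u (I : Type) (r : seq I) (P : pred I)
    (F : I -> {mpoly K[n]}) :
  translate_along u (\prod_(i <- r | P i) F i) =
  \prod_(i <- r | P i) translate_along u (F i).
Proof. by rewrite translate_alongE rmorph_prod. Qed.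

Lemma translate_alongC u c : translate_along u c%:MP = c%:MP%:P.
Proof. by rewrite translate_alongE mmapC. Qed.

Lemma translate_along_var u k :
  translate_along u 'X_k = ('X_k)%:P + ((u 0 k)%:MP_[n]) *: 'X.
Proof. by rewrite translate_alongE mmapX mmap1U. Qed.

Lemma dir_derivD u h F G :
  dir_deriv u h (F + G) = dir_deriv u h F + dir_deriv u h G.
Proof. by rewrite /dir_deriv translate_alongD coefD. Qed.

Lemma dir_derivZ u h c F : dir_deriv u h (c *: F) = c *: dir_deriv u h F.
Proof.
by rewrite /dir_deriv -!mul_mpolyC translate_alongM translate_alongC coefCM.
Qed.

Lemma dir_derivM u h F G :
  dir_deriv u h (F * G) =
  \sum_(k < h.+1) dir_deriv u k F * dir_deriv u (h - k) G.
Proof. by rewrite /dir_deriv translate_alongM coefM. Qed.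

(** By linearity it suffices to look at monomials, and on these setting s = 0,
    a ring morphism, can be done variable by variable. *)
Lemma dir_deriv0 u F : dir_deriv u 0 F = F.
Proof.
elim/mpolyind: F => [|c m F _ _ IH].
  by rewrite -[0]mpolyC0 /dir_deriv translate_alongC coefC.
rewrite dir_derivD dir_derivZ IH; congr (_ *: _ + _).
rewrite /dir_deriv -horner_coef0 mpolyXE_id translate_along_prod horner_prod.
apply: eq_bigr => k _; rewrite translate_alongX translate_along_var.
by rewrite horner_exp hornerD hornerC hornerZ hornerX mulr0 addr0.
Qed.

(** By the Leibniz rule, a derivative of order h removes at most h of the N
    factors f.  The subtraction is truncated, so nothing is claimed once
    h >= N. *)
Lemma dir_deriv_pow_dvd u f N g h :
  exists g', dir_deriv u h (f ^+ N * g) = f ^+ (N - h) * g'.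
Proof.
elim: N h => [|N IH] h.
  by exists (dir_deriv u h (f ^+ 0 * g)); rewrite sub0n expr0 !mul1r.
rewrite [f ^+ N.+1]exprS -mulrA dir_derivM.
apply: (big_ind (fun G => exists g', G = f ^+ (N.+1 - h) * g')).
- by exists 0; rewrite mulr0.
- by move=> _ _ [g1 ->] [g2 ->]; exists (g1 + g2); rewrite mulrDr.
move=> [k /= lt_kh] _; have [g' ->] := IH (h - k)%N.
(* For k = 0 the factor f itself survives; for k > 0 the other factor has lost
   at most h - k < h powers of f. *)
case: k lt_kh => [_ | k lt_kh].
  rewrite dir_deriv0 subn0; have [le_hN | lt_Nh] := leqP h N.
    by exists g'; rewrite subSn // exprS mulrA.
  exists (f * (f ^+ (N - h) * g')).
  by move: lt_Nh; rewrite -subn_eq0 => /eqP ->; rewrite mul1r.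
have le_exp : (N.+1 - h <= N - (h - k.+1))%N by lia.
exists (f ^+ (N - (h - k.+1) - (N.+1 - h)) * (dir_deriv u k.+1 f * g')).
by rewrite [RHS]mulrA -exprD subnKC // mulrCA.
Qed.

(** * Derivatives along several directions *)

Section IteratedDerivative.

Variables (s : nat) (U : 'M[K]_(s, n)).
Implicit Types (h : {ffun 'I_s -> nat}).

Lemma multi_derivD h F G :
  multi_deriv U h (F + G) = multi_deriv U h F + multi_deriv U h G.
Proof.
by rewrite /multi_deriv; elim: (enum 'I_s) => //= j r ->; rewrite dir_derivD.
Qed.

Lemma multi_derivZ h c F : multi_deriv U h (c *: F) = c *: multi_deriv U h F.
Proof.
by rewrite /multi_deriv; elim: (enum 'I_s) => //= j r ->; rewrite dir_derivZ.
Qed.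

Lemma multi_deriv_sum h (I : Type) (r : seq I) (P : pred I)
    (F : I -> {mpoly K[n]}) :
  multi_deriv U h (\sum_(i <- r | P i) F i) =
  \sum_(i <- r | P i) multi_deriv U h (F i).
Proof.
apply: (big_morph _ (multi_derivD h)).
by rewrite -(scale0r 0) multi_derivZ !scale0r.
Qed.

Lemma multi_deriv_pow_dvd h f N g :
  exists g', multi_deriv U h (f ^+ N * g) = f ^+ (N - \sum_j h j) * g'.
Proof.
rewrite /multi_deriv -(big_enum _ _ xpredT h) /=.
elim: (enum _) => [|j r [g' /= ->]]; first by exists g; rewrite big_nil subn0.
have [g'' ->] := dir_deriv_pow_dvd (row j U) f (N - \sum_(j <- r) h j) g' (h j).
by exists g''; rewrite big_cons -subnDA addnC.
Qed.

(** This makes N-th powers negligible: modulo f^N, the derivatives of total order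
    below N at a zero of f do not change. *)
Lemma multi_deriv_pow_eq0 h f N g p :
  f @! p = 0 -> (\sum_j h j < N)%N -> (multi_deriv U h (f ^+ N * g)) @! p = 0.
Proof.
move=> fp0 ltN; have [g' ->] := multi_deriv_pow_dvd h f N g.
by rewrite mevalM rmorphXn /= fp0 expr0n subn_eq0 leqNgt ltN mul0r.
Qed.

End IteratedDerivative.

(** * Interpolation at one point *)

Section DualCoordinates.

Variables (s : nat) (U : 'M[K]_(s, n)) (V : 'M[K]_(n, s)) (p : 'rV[K]_n).
Hypothesis UV1 : U *m V = 1%:M.

(** The j-th coordinate with respect to the rows of U, with origin p: the right
    inverse V picks one such affine form when the rows do not span. *)
Definition dual_coord (j : 'I_s) : {mpoly K[n]} :=
  \sum_k V k j *: ('X_k - (p 0 k)%:MP).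

Lemma dual_coord_eq0 j : (dual_coord j) @! p = 0.
Proof.
rewrite raddf_sum big1 //= => k _.
by rewrite mevalZ mevalB mevalXU mevalC subrr mulr0.
Qed.

Lemma translate_along_dual_coord i j :
  translate_along (row i U) (dual_coord j) =
  (dual_coord j)%:P + (i == j)%:R *: 'X.
Proof.
(* The slope is the (i, j) entry of U *m V, the identity matrix. *)
have -> : (i == j)%:R = \sum_k (V k j * U i k)%:MP_[n].
  rewrite -raddf_sum /= -mpolyC_nat; congr _%:MP.
  have := congr1 (fun M : 'M_s => M i j) UV1; rewrite !mxE => <-.
  by apply: eq_bigr => k _; rewrite mulrC.
rewrite translate_alongE raddf_sum [in RHS]raddf_sum scaler_suml -big_split /=.
apply: eq_bigr => k _; rewrite -translate_alongE -mul_mpolyC.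
rewrite translate_alongM translate_alongD -mpolyCN !translate_alongC.
rewrite translate_along_var mxE mpolyCM polyCM polyCD -!mul_polyC polyCM.
by rewrite -mulrA -mulrDr addrAC.
Qed.

Lemma dir_deriv_dual_monomial i a (g : 'I_s -> nat) :
  dir_deriv (row i U) a (\prod_j dual_coord j ^+ g j) =
  'C(g i, a)%:R *: \prod_j dual_coord j ^+ (g j - (j == i) * a).
Proof.
rewrite /dir_deriv translate_along_prod (bigD1 i) //= translate_alongX.
rewrite translate_along_dual_coord eqxx scale1r.
under eq_bigr => j /negPf ji.
  rewrite translate_alongX translate_along_dual_coord eq_sym ji scale0r addr0.
  rewrite -polyC_exp; over.
rewrite -rmorph_prod /= coefMC coef_exp_CaddX.
rewrite [in RHS](bigD1 i) //= eqxx mul1n scaler_nat mulrnAl.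
congr (_ * _ *+ _); apply: eq_bigr => j /negPf ->.
by rewrite mul0n subn0.
Qed.

(** The derivative along row i only lowers the exponent of the i-th coordinate,
    so the exponents can be tracked for each duplicate-free list r of rows already
    processed; r = [enum 'I_s] gives [multi_deriv]. *)
Lemma foldr_dir_deriv_dual_monomial (g h : 'I_s -> nat) (r : seq 'I_s) :
  uniq r ->
  foldr (fun j G => dir_deriv (row j U) (h j) G)
    (\prod_j dual_coord j ^+ g j) r =
  (\prod_(j <- r) 'C(g j, h j)%:R) *:
    \prod_j dual_coord j ^+ (g j - (j \in r) * h j).
Proof.
elim: r => [|i r IH] /=.
  rewrite big_nil scale1r => _.
  by apply: eq_bigr => j _; rewrite mul0n subn0.
case/andP => nir /IH ->; rewrite dir_derivZ.
rewrite (dir_deriv_dual_monomial i (h i) (fun j => g j - (j \in r) * h j)%N).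
rewrite (negPf nir) mul0n subn0.
rewrite scalerA big_cons mulrC; congr (_ *: _); apply: eq_bigr => j _.
rewrite in_cons; case: eqVneq => [->|_] /=; last by rewrite mul0n subn0.
by rewrite (negPf nir) mul0n subn0.
Qed.

(** The monomials in the dual coordinates are a dual basis to the derivatives at
    p.  If g_j < h_j the binomial coefficient vanishes, and if g_j > h_j a power
    of the coordinate, which is zero at p, is left over. *)
Lemma multi_deriv_dual_monomial (g h : {ffun 'I_s -> nat}) :
  (multi_deriv U h (\prod_j dual_coord j ^+ g j)) @! p = (g == h)%:R.
Proof.
rewrite /multi_deriv foldr_dir_deriv_dual_monomial ?enum_uniq //.
rewrite mevalZ rmorph_prod /= big_enum /= -big_split /=.
have [-> | neq_gh] := eqVneq g h.
  by rewrite big1 // => j _; rewrite mem_enum mul1n subnn binn expr0 meval1 mulr1.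
have [j neq_j] : exists j, g j != h j.
  apply/existsP; apply: contraNT neq_gh; rewrite negb_exists => /forallP eq_gh.
  by apply/eqP/ffunP => j; apply/eqP/negPn.
rewrite (bigD1 j) //= mem_enum mul1n rmorphXn /= dual_coord_eq0 expr0n subn_eq0.
have [lt_gh | lt_hg | eq_gh] := ltngtP (g j) (h j).
- by rewrite bin_small // !mul0r.
- by rewrite mulr0 mul0r.
- by rewrite eq_gh eqxx in neq_j.
Qed.

End DualCoordinates.

Lemma exists_prescribed_multi_deriv s (U : 'M[K]_(s, n)) p
    (H : {fset {ffun 'I_s -> nat}}) (v : {ffun 'I_s -> nat} -> K) :
  row_free U ->
  exists G, forall h, h \in H -> (multi_deriv U h G) @! p = v h.
Proof.
move=> U_free; have UV1 := mulmxVp U_free.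
exists (\sum_(g <- H) v g *: \prod_j dual_coord (pinvmx U) p j ^+ g j) => h hH.
rewrite multi_deriv_sum raddf_sum /=.
under eq_bigr => g _.
  rewrite multi_derivZ mevalZ (multi_deriv_dual_monomial p UV1 g h); over.
rewrite (bigD1_seq h) //= eqxx mulr1 big1 ?addr0 // => g /negPf neq_gh.
by rewrite neq_gh mulr0.
Qed.

(** * Decoupling the points *)

Definition separator p q : {mpoly K[n]} :=
  if [pick k | p 0 k != q 0 k] is Some k
  then (p 0 k - q 0 k)^-1 *: ('X_k - (q 0 k)%:MP) else 0.

Lemma separator_eq1 p q : p != q -> (separator p q) @! p = 1.
Proof.
move=> neq_pq; rewrite /separator; case: pickP => [k neq_k | eq_pq].
  by rewrite mevalZ mevalB mevalXU mevalC mulVf // subr_eq0.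
by case/eqP: neq_pq; apply/rowP => k; apply/eqP/negPn; rewrite eq_pq.
Qed.

Lemma separator_eq0 p q : (separator p q) @! q = 0.
Proof.
rewrite /separator; case: pickP => [k _|_]; last by rewrite meval0.
by rewrite mevalZ mevalB mevalXU mevalC subrr mulr0.
Qed.

(** E is congruent to 1 at p_i and to 0 at the other points, up to N-th powers of
    polynomials vanishing there.  The outer power is what corrects the terms of
    order between 1 and N - 1 of Q = prod_j L_{ij}^N at p_i: there 1 - Q merely
    vanishes, while (1 - Q)^N is negligible. *)
Lemma exists_local_idempotent t (p : 'I_t -> 'rV[K]_n) N i :
  (forall i j : 'I_t, i != j -> p i != p j) ->
  exists E : {mpoly K[n]},
    (exists2 f, f @! (p i) = 0 & E = 1 - f ^+ N) /\
    (forall j, j != i ->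
       exists f g, f @! (p j) = 0 /\ E = f ^+ N * g).
Proof.
move=> p_inj; pose Q := \prod_(j | j != i) separator (p i) (p j) ^+ N.
exists (1 - (1 - Q) ^+ N); split.
  exists (1 - Q) => //.
  rewrite mevalB meval1 rmorph_prod /= big1 ?subrr // => j ji.
  by rewrite rmorphXn /= separator_eq1 ?expr1n // p_inj // eq_sym.
have QE : 1 - (1 - Q) = Q by rewrite opprB addrC subrK.
move=> j ji; exists (separator (p i) (p j)).
(* 1^N - (1 - Q)^N is a multiple of 1 - (1 - Q) = Q. *)
rewrite -[X in X - _](expr1n _ N) subrXX QE /Q (bigD1 j) //= -mulrA.
by eexists; split; [exact: separator_eq0 | reflexivity].
Qed.

End DirectionalDerivative.

Theorem theorem3p1 (K : fieldType) (n t : nat) (hn : (1 <= n)%N) (ht : (1 <= t)%N)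
    (p : 'I_t -> 'rV[K]_n) (hp : forall i j : 'I_t, i != j -> p i != p j)
    (s : 'I_t -> nat) (hs : forall i : 'I_t, (1 <= s i)%N)
    (U : forall i : 'I_t, 'M[K]_(s i, n))
    (hU_free : forall i : 'I_t, row_free (U i))
    (hU_unitary : forall (i : 'I_t) (j : 'I_(s i)), unitary (row j (U i)))
    (H : forall i : 'I_t, {fset {ffun 'I_(s i) -> nat}})
    (v : forall i : 'I_t, {ffun 'I_(s i) -> nat} -> K) :
  exists F : {mpoly K[n]},
    forall (i : 'I_t) (h : {ffun 'I_(s i) -> nat}),
      h \in H i -> (multi_deriv (U i) h F).@[fun k : 'I_n => p i 0 k] = v i h.
Proof.
pose N := (\max_i \max_(h <- H i) \sum_j h j).+1.
have ltN i h : h \in H i -> (\sum_j h j < N)%N.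
  move=> hH; rewrite ltnS; apply: leq_trans (leq_bigmax i) => /=.
  by rewrite (bigD1_seq h) //= leq_maxl.
have [G G_spec] := fin_all_exists (fun i =>
  exists_prescribed_multi_deriv (p i) (H i) (v i) (hU_free i)).
have [E E_spec] := fin_all_exists (fun i => exists_local_idempotent N i hp).
exists (\sum_i E i * G i) => i h hH.
rewrite multi_deriv_sum raddf_sum /= (bigD1 i) //= big1 ?addr0 => [|j ji].
  have [[f fp0 ->] _] := E_spec i.
  rewrite mulrBl mul1r -mulrN multi_derivD mevalD G_spec //.
  by rewrite multi_deriv_pow_eq0 ?addr0 ?ltN.
have [_ /(_ i) [|f [g [fp0 ->]]]] := E_spec j; first by rewrite eq_sym.
by rewrite -mulrA multi_deriv_pow_eq0 ?ltN.
Qed.
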